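(* Let $\mathcal{C}$ be a uniform clutter with incidence matrix $A$, whose column vectors are $v_1,\ldots,v_q\in\{0,1\}^n$. If $\mathcal{C}$ has the max-flow min-cut property, then: (a) $\Delta_r(A)=1$, where $r=\operatorname{rank}(A)$; (b) $\mathbb{N}\mathcal{A}=\mathbb{R}_+\mathcal{A}\cap\mathbb{Z}^n$, where $\mathcal{A}=\{v_1,\ldots,v_q\}$.
   Context: A clutter $\mathcal{C}$ with finite vertex set $X=\{x_1,\ldots,x_n\}$ is a family of subsets of $X$ (called edges), none of which is included in another. Standing assumption: $\mathcal{C}$ has no isolated vertices, i.e., each vertex lies in at least one edge. $\mathcal{C}$ is uniform if all its edges have the same number $d$ of vertices. If $f_1,\ldots,f_q$ are the edges, the incidence matrix $A$ is the $n\times q$ matrix whose columns are $v_k=\sum_{x_i\in f_k}e_i$. $\mathcal{C}$ has the max-flow min-cut property if for every non-negative integral vector $\alpha\in\mathbb{N}^n$ both sides of the LP-duality equation $\min\{\langle\alpha,x\rangle \mid x\geq 0,\ xA\geq\mathbf{1}\}=\max\{\langle y,\mathbf{1}\rangle \mid y\geq 0,\ Ay\leq\alpha\}$ have integral optimum solutions $x$ and $y$, where $\mathbf{1}=(1,\ldots,1)$. $\Delta_r(A)$ denotes the greatest common divisor of all the nonzero $r\times r$ sub-determinants of $A$. $\mathbb{N}\mathcal{A}$ is the set of all linear combinations of elements of $\mathcal{A}$ with coefficients in $\mathbb{N}=\{0,1,2,\ldots\}$, and $\mathbb{R}_+\mathcal{A}$ is the cone of all linear combinations with non-negative real coefficients.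 *)

(* Defs.v *)
From mathcomp Require Import all_boot all_order all_algebra.
From mathcomp Require Import classical_sets reals.

Set Implicit Arguments.
Unset Strict Implicit.
Unset Printing Implicit Defensive.

Import Order.TTheory GRing.Theory Num.Theory.
Local Open Scope ring_scope.

(** * Clutters on the vertex set ['I_n] *)

Definition clutter (n : nat) (C : {set {set 'I_n}}) : Prop :=
  forall e f : {set 'I_n}, e \in C -> f \in C -> e \subset f -> e = f.

Definition no_isolated_vertex (n : nat) (C : {set {set 'I_n}}) : Prop :=
  forall i : 'I_n, exists2 e : {set 'I_n}, e \in C & i \in e.

Definition uniform (n : nat) (C : {set {set 'I_n}}) : Prop :=
  exists d : nat, forall e : {set 'I_n}, e \in C -> #|e| = d.

(* The edges f_1, ..., f_q are listed by [enum_val : 'I_#|C| -> {set 'I_n}]. *)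
Definition incidence (R : pzRingType) (n : nat) (C : {set {set 'I_n}}) :
    'M[R]_(n, #|C|) :=
  \matrix_(i < n, k < #|C|) (i \in enum_val k)%:R.

(** * Max-flow min-cut property *)

Definition le_mx (R : realType) (m n : nat) (A B : 'M[R]_(m, n)) : Prop :=
  forall i j, A i j <= B i j.

Definition integral_mx (R : realType) (m n : nat) (A : 'M[R]_(m, n)) : Prop :=
  forall i j, A i j \is a Num.int.

Definition minimizes (R : realType) (V : Type) (P : V -> Prop) (h : V -> R)
    (x : V) : Prop :=
  P x /\ forall x', P x' -> h x <= h x'.

Definition maximizes (R : realType) (V : Type) (P : V -> Prop) (h : V -> R)
    (x : V) : Prop :=
  P x /\ forall x', P x' -> h x' <= h x.

Definition primal_feasible (R : realType) (n q : nat) (A : 'M[R]_(n, q))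
    (x : 'rV[R]_n) : Prop :=
  le_mx 0 x /\ le_mx (const_mx 1) (x *m A).

Definition dual_feasible (R : realType) (n q : nat) (A : 'M[R]_(n, q))
    (a : 'cV[R]_n) (y : 'cV[R]_q) : Prop :=
  le_mx 0 y /\ le_mx (A *m y) a.

(* Optimality is over all real feasible points; the equality of the two
   optimal values is not part of the definition, since it is LP duality. *)
Definition max_flow_min_cut (R : realType) (n : nat) (C : {set {set 'I_n}}) :
    Prop :=
  forall alpha : 'I_n -> nat,
    let A := incidence R C in
    let a : 'cV[R]_n := \col_i (alpha i)%:R in
    (exists2 x : 'rV[R]_n,
       minimizes (primal_feasible A) (fun x => (x *m a) 0 0) x &
       integral_mx x) /\
    (exists2 y : 'cV[R]_#|C|,
       maximizes (dual_feasible A a) (fun y => \sum_k y k 0) y &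
       integral_mx y).

(** * Determinantal divisors *)

Definition increasing (r n : nat) (f : {ffun 'I_r -> 'I_n}) : bool :=
  [forall i : 'I_r, forall j : 'I_r, (i < j)%N ==> (f i < f j)%N].

(* An r x r submatrix is given by strictly increasing selections of r rows and
   r columns. *)
Definition Delta (n q : nat) (r : nat) (A : 'M[int]_(n, q)) : nat :=
  \big[gcdn/0%N]_(f : {ffun 'I_r -> 'I_n} | increasing f)
    \big[gcdn/0%N]_(g : {ffun 'I_r -> 'I_q} |
                     increasing g && (\det (mxsub f g A) != 0))
      `|\det (mxsub f g A)|%N.

(** * The semigroup and the cone spanned by the columns of a matrix *)

Definition nat_span (R : realType) (n q : nat) (A : 'M[R]_(n, q)) :
    set 'cV[R]_n :=
  fun w => exists c : 'I_q -> nat, w = \sum_k (c k)%:R *: col k A.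

Definition real_cone (R : realType) (n q : nat) (A : 'M[R]_(n, q)) :
    set 'cV[R]_n :=
  fun w => exists c : 'I_q -> R,
    (forall k, 0 <= c k) /\ w = \sum_k c k *: col k A.

Definition integer_lattice (R : realType) (n : nat) : set 'cV[R]_n :=
  fun w => integral_mx w.
Arguments integer_lattice : clear implicits.

(* Main.v *)
(** A nonnegative real combination [w = A c] lying in Z^n is itself an admissible
    capacity vector.  Each edge has [d] vertices, so every feasible dual solution
    has total weight at most [|w| / d], with equality exactly when it attains
    [A y = w]; as [c] attains this bound, an integral optimum writes [w] as an
    element of N A.  This is (b).  Adding a large multiple of the sum of the
    columns turns (b) into: the integral points of the column space of [A] are
    the integral combinations of the columns.  Such a saturated integer matrix
    has Smith normal form [pid_mx t], hence the same rank over R and over every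
    field F_p, so that no prime divides all of its maximal minors. *)
Require Import Defs.
From mathcomp Require Import all_boot all_order all_algebra.
From mathcomp Require Import classical_sets reals.

Local Open Scope ring_scope.
Local Open Scope classical_set_scope.

Set Implicit Arguments.
Unset Strict Implicit.
Unset Printing Implicit Defensive.

Import Order.TTheory GRing.Theory Num.Theory.

Lemma enum_val_ltn (n : nat) (S : {set 'I_n}) (i j : 'I_#|S|) :
  (i < j)%N -> (enum_val i < enum_val j)%N.
Proof.
move=> lt_ij; have x0 := enum_val i; rewrite !(enum_val_nth x0).
have srt : sorted (relpre val ltn) (enum S).
  rewrite /enum_mem -enumT; apply: sorted_filter; first by move=> a b c; apply: ltn_trans.
  by rewrite -sorted_map val_enum_ord iota_ltn_sorted.
apply: (sorted_ltn_nth _ _ srt) => //; first by move=> a b c; apply: ltn_trans.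
- by rewrite inE -cardE.
- by rewrite inE -cardE.
Qed.

(** [maxrankfun] picks independent rows in no prescribed order; listing its image increasingly keeps
    every chosen row, hence the rank. *)
Lemma increasing_row_free (F : fieldType) (m n r : nat) (A : 'M[F]_(m, n)) :
  \rank A = r ->
  exists2 f : {ffun 'I_r -> 'I_m}, increasing f & row_free (rowsub f A).
Proof.
move=> <-; set h := maxrankfun A.
pose S := (h @: 'I_(\rank A))%SET.
have cardS : \rank A = #|S|.
  by rewrite card_imset ?card_ord //; apply: maxrankfun_inj.
exists [ffun i => enum_val (cast_ord cardS i)].
  apply/forallP=> i; apply/forallP=> j; apply/implyP=> lt_ij.
  by rewrite !ffunE; apply: enum_val_ltn.
rewrite /row_free mxsub_ffunl eqn_leq rank_leq_row /=.
rewrite -[X in (X <= _)%N](eqP (maxrowsub_free A)); apply: mxrankS.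
apply/row_subP=> i.
have hS : h i \in S by apply: imset_f.
apply: (@eq_row_sub _ _ _ _ _ (cast_ord (esym cardS) (enum_rank_in hS (h i)))).
by apply/rowP=> k; rewrite !mxE cast_ordKV enum_rankK_in.
Qed.

Lemma exists_nonzero_minor (F : fieldType) (m n r : nat) (A : 'M[F]_(m, n)) :
  \rank A = r ->
  exists (f : {ffun 'I_r -> 'I_m}) (g : {ffun 'I_r -> 'I_n}),
    [/\ increasing f, increasing g & \det (mxsub f g A) != 0].
Proof.
move=> rkA; have [f incf freef] := increasing_row_free rkA.
have [g incg freeg] : exists2 g : {ffun 'I_r -> 'I_n},
    increasing g & row_free (rowsub g (rowsub f A)^T).
  by apply: increasing_row_free; rewrite mxrank_tr; apply/eqP.
exists f, g; split=> //.
move: freeg; rewrite row_free_unit unitmxE unitfE -det_tr.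
by congr (\det _ != 0); apply/matrixP=> i j; rewrite !mxE.
Qed.

Lemma prime_dvd_minors_rank (n q r p : nat) (A : 'M[int]_(n, q)) :
  prime p -> \rank (map_mx (intr : int -> 'F_p) A) = r -> ~~ (p %| Delta r A)%N.
Proof.
move=> pp /exists_nonzero_minor [f [g [incf incg nz]]].
apply: contra nz => dv.
rewrite -map_mxsub det_map_mx; apply/eqP.
(* [Delta] skips zero minors, but these vanish mod [p] anyway. *)
have [-> //|nz] := eqVneq (\det (mxsub f g A)) 0.
apply/eqP; rewrite -(dvdz_pcharf (pchar_Fp pp)) dvdzE.
apply: (dvdn_trans dv); apply: (biggcdn_inf f) => //.
by apply: (biggcdn_inf g) => //; rewrite incg.
Qed.


(** A determinant that is a unit of Z stays a unit in every field, so [U] and [V] remain invertible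
    whatever the characteristic. *)
Lemma rank_pid_mx_equiv (F : fieldType) (n q t : nat) (U : 'M[int]_n)
    (V : 'M[int]_q) :
  U \in unitmx -> V \in unitmx -> (t <= n)%N -> (t <= q)%N ->
  \rank (map_mx (intr : int -> F) (U *m pid_mx t *m V)) = t.
Proof.
have unit_map m (M : 'M[int]_m) :
    M \in unitmx -> map_mx (intr : int -> F) M \in unitmx.
  by rewrite !unitmxE det_map_mx; apply: rmorph_unit.
move=> Uu Vu tn tq; rewrite !map_mxM map_pid_mx.
rewrite mxrankMfree ?row_free_unit ?unit_map //.
rewrite -mxrank_tr trmx_mul mxrankMfree ?mxrank_tr ?rank_pid_mx //.
by rewrite row_free_unit unitmx_tr unit_map.
Qed.

Lemma pid_mx_equiv_Delta (n q t : nat) (U : 'M[int]_n) (V : 'M[int]_q) :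
  U \in unitmx -> V \in unitmx -> (t <= n)%N -> (t <= q)%N ->
  Delta t (U *m pid_mx t *m V) = 1%N.
Proof.
move=> Uu Vu tn tq.
have ndv p : prime p -> ~~ (p %| Delta t (U *m pid_mx t *m V))%N.
  by move=> pp; apply: prime_dvd_minors_rank => //; apply: rank_pid_mx_equiv.
case: (ltngtP (Delta t (U *m pid_mx t *m V)) 1) => //.
  (* The value 0, that of an empty gcd, is excluded because 2 divides it. *)
  by rewrite ltnS leqn0 => /eqP D0; move: (ndv 2 isT); rewrite D0 dvdn0.
by move/pdiv_prime/ndv; rewrite pdiv_dvd.
Qed.

(** In the Smith form [L D S], a nonzero invariant factor puts the matching column of [L] in the
    column space over [F]; saturation makes it an integral combination, which forces the factor to
    be a unit. *)
Lemma saturated_pid_mx_equiv (F : numFieldType) (n q : nat) (A : 'M[int]_(n, q)) :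
  (forall (x : 'cV[int]_n) (c : 'cV[F]_q),
     map_mx intr x = map_mx intr A *m c -> exists z, x = A *m z) ->
  exists (t : nat) (U : 'M[int]_n) (V : 'M[int]_q),
    [/\ U \in unitmx, V \in unitmx, (t <= n)%N, (t <= q)%N &
        A = U *m pid_mx t *m V].
Proof.
move=> sat.
have [L Lu [S Su [d srt_d defA]]] := int_Smith_normal_form A.
set D := (X in _ *m X *m _) in defA.
have unit_d (i : 'I_n) (j : 'I_q) : i = j :> nat -> d`_i != 0 ->
    d`_i \is a GRing.unit.
  move=> ij nz.
  have D_delta : D *m delta_mx j 0 = d`_i *: delta_mx i 0 :> 'cV_n.
    apply/colP=> k; rewrite -colE !mxE eqxx andbT -ij -val_eqE /=.
    by have [->|_] := eqVneq (k : nat) i; rewrite ?mulr1 ?mulr0.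
  (* The coefficients come from [A S^-1 e_j = d_i L e_i]. *)
  have [|z defz] := sat (L *m delta_mx i 0)
      ((d`_i)%:~R^-1 *: map_mx intr (invmx S *m delta_mx j 0)).
    rewrite -scalemxAr -map_mxM defA -!mulmxA mulKVmx // D_delta.
    rewrite -scalemxAr map_mxZ scalerA mulVf ?scale1r //.
    by rewrite intr_eq0.
  have /colP/(_ i) : delta_mx i 0 = D *m (S *m z).
    by rewrite -[LHS](mulKmx Lu) defz defA -!mulmxA mulKmx.
  rewrite !mxE !eqxx (bigD1 j) //= big1 ?addr0; last first.
    by move=> k; rewrite !mxE ij -val_eqE /= eq_sym => /negPf->; rewrite mul0r.
  rewrite mxE ij eqxx mulr1n => /esym d1.
  by apply/unitrP; exists ((S *m z) j 0); rewrite mulrC d1.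
(* By the divisibility chain, everything from the first zero on is zero; past the end of [d] the
   default of [nth] is 0 too. *)
pose s := find (pred1 0) d.
have nzd i : (i < s)%N -> d`_i != 0 by move=> /(before_find 0) /= ->.
have zd i : (s <= i)%N -> d`_i = 0.
  move=> le_si; have [lt_i|le_i] := ltnP i (size d); last by rewrite nth_default.
  have lt_s : (s < size d)%N by apply: leq_ltn_trans lt_i.
  have ds0 : d`_s = 0 by apply/eqP; have := nth_find 0 (a := pred1 0) (s := d); rewrite has_find; apply.
  have := sorted_leq_nth (@dvdz_trans) (@dvdzz) 0 srt_d s i lt_s lt_i le_si.
  by rewrite ds0 dvd0z => /eqP.
pose t := minn s (minn n q).
(* The unit factors are moved into the left matrix; padding with 1 keeps the diagonal invertible. *)
pose e := \row_(i < n) (if (i < t)%N then d`_i else 1).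
have eu : diag_mx e \in unitmx.
  rewrite unitmxE det_diag; apply: rpred_prod => i _; rewrite mxE.
  case: ifP => [|_]; last exact: unitr1.
  rewrite !leq_min => /and3P[lt_is _ lt_iq].
  exact: (unit_d i (Ordinal lt_iq)) (nzd _ _).
exists t, (L *m diag_mx e), S; split=> //.
- by rewrite unitmx_mul Lu.
- by rewrite /t minnCA geq_minl.
- by rewrite /t minnA geq_minr.
rewrite defA; congr (_ *m _); rewrite -mulmxA; congr (_ *m _).
apply/matrixP=> i j; rewrite mul_diag_mx !mxE.
have [ij|] := eqVneq (i : nat) j; last by rewrite mulr0.
have -> : (i < t)%N = (i < s)%N by rewrite !leq_min ltn_ord {2}ij ltn_ord !andbT.
by case: ltnP => [|/zd->]; rewrite ?mulr1 ?mulr0.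
Qed.

Section Clutter.
Variables (R : realType) (n : nat) (C : {set {set 'I_n}}).
Let A := incidence R C.

Lemma sum_col_mulmx (c : 'I_#|C| -> R) :
  \sum_k c k *: col k A = A *m \col_k c k.
Proof.
apply/colP=> i; rewrite summxE !mxE; apply: eq_bigr => k _.
by rewrite !mxE mulrC.
Qed.

(** Double counting: each column of the incidence matrix sums to [d]. *)
Lemma sum_incidence_mulmx (d : nat) (y : 'cV[R]_#|C|) :
  (forall e : {set 'I_n}, e \in C -> #|e| = d) ->
  \sum_i (A *m y) i 0 = d%:R * \sum_k y k 0.
Proof.
move=> cardC; under eq_bigr do rewrite mxE.
rewrite exchange_big mulr_sumr; apply: eq_bigr => k _.
rewrite -mulr_suml; congr (_ * _).
transitivity (#|enum_val k|%:R : R); last by rewrite (cardC _ (enum_valP k)).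
rewrite -[in RHS]sum1_card natr_sum [RHS]big_mkcond.
by apply: eq_bigr => i _; rewrite mxE; case: (i \in _).
Qed.

Lemma mfmc_nat_span :
  no_isolated_vertex C -> uniform C -> max_flow_min_cut R C ->
  nat_span A = real_cone A `&` integer_lattice R n.
Proof.
move=> iso [d cardC] mfmc; apply/seteqP; split=> w.
  case=> c ->; split; first by exists (fun k => (c k)%:R).
  move=> i j; rewrite summxE; apply: rpred_sum => k _.
  by rewrite !mxE -natrM; apply: natr_int.
case=> -[c [c_ge0 ->]]; rewrite sum_col_mulmx; set cc := \col_k c k => w_int.
have w_nat i : (A *m cc) i 0 \is a Num.nat.
  rewrite -intrEge0; first exact: w_int.
  by rewrite mxE sumr_ge0 // => k _; rewrite !mxE mulr_ge0.
have [_ [y [[y_ge0 Ay] y_max] y_int]] := mfmc (fun i => Num.truncn ((A *m cc) i 0)).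
set a := \col_i _ in Ay y_max.
have aE : a = A *m cc.
  by apply/colP=> i; rewrite mxE truncnK.
rewrite aE in Ay y_max.
(* Positivity of [d] needs a vertex; for [n = 0] there is no coordinate to compare. *)
have d_gt0 (i : 'I_n) : (0 < d)%N.
  by have [e eC ie] := iso i; rewrite -(cardC e eC); apply/card_gt0P; exists i.
have AyE : A *m y = A *m cc.
  apply/colP=> i; apply/eqP; rewrite eq_le Ay /= -subr_ge0 -oppr_le0 opprB.
  have le_sum : \sum_k cc k 0 <= \sum_k y k 0.
    by apply: y_max; split=> // k j; rewrite !mxE.
  (* The slacks are nonnegative with sum at most 0, so each one vanishes. *)
  have : \sum_i ((A *m cc) i 0 - (A *m y) i 0) <= 0.
    rewrite big_split sumrN /= !(sum_incidence_mulmx _ cardC) -mulrBr.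
    by rewrite pmulr_rle0 ?ltr0n ?(d_gt0 i) // subr_le0.
  rewrite (bigD1 i) //=; apply: le_trans.
  rewrite -[X in X <= _]opprB opprB lerDl; apply: sumr_ge0 => j _.
  by rewrite subr_ge0 Ay.
exists (fun k => Num.truncn (y k 0)); rewrite sum_col_mulmx -AyE; congr (_ *m _).
apply/colP=> k; rewrite mxE truncnK // -intrEge0 ?y_int //.
by have := y_ge0 k 0; rewrite mxE.
Qed.

End Clutter.

Theorem theorem3p6 (R : realType) (n : nat) (C : {set {set 'I_n}})
    (C_clutter : clutter C) (C_no_isolated : no_isolated_vertex C)
    (C_uniform : uniform C) (C_mfmc : max_flow_min_cut R C) :
  Delta (\rank (incidence R C)) (incidence int C) = 1%N /\
  nat_span (incidence R C) = real_cone (incidence R C) `&` integer_lattice R n.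
Proof.

have spanE := mfmc_nat_span C_no_isolated C_uniform C_mfmc; split=> //.
have incE : map_mx (intr : int -> R) (incidence int C) = incidence R C.
  by apply/matrixP=> i k; rewrite !mxE; case: (i \in _).
have [|t [U [V [Uu Vu tn tq defA]]]] :=
    @saturated_pid_mx_equiv R _ _ (incidence int C).
  move=> x c; rewrite incE => xE.
  (* [N] bounds every [|c k 0|], so adding [N] copies of each column moves [x] into the cone. *)
  pose b k := Num.bound `|c k 0|; pose N := (\sum_k b k)%N.
  have cN k : 0 <= c k 0 + N%:R.
    have /ltW le_b := archi_boundP (normr_ge0 (c k 0)).
    have le_N : (b k <= N)%N by rewrite /N (bigD1 k) //= leq_addr.
    rewrite -lerBlDr sub0r (le_trans _ (lerNnormlW (lexx `|c k 0|))) // lerN2.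
    by rewrite (le_trans le_b) // ler_nat.
  have : nat_span (incidence R C) (map_mx intr x + incidence R C *m const_mx N%:R).
    rewrite spanE; split.
      exists (fun k => c k 0 + N%:R); split=> //.
      rewrite sum_col_mulmx xE -mulmxDr; congr (_ *m _).
      by apply/colP=> k; rewrite !mxE.
    move=> i j; rewrite !mxE; apply: rpredD; first exact: intr_int.
    by apply: rpred_sum => k _; rewrite !mxE -natrM; apply: natr_int.
  case=> m; rewrite sum_col_mulmx => mE.
  (* Subtracting the [N] copies again leaves integral coefficients, possibly negative. *)
  exists (\col_k ((m k)%:R - N%:R)).
  have map_inj : injective (map_mx (intr : int -> R) : 'cV_n -> 'cV_n).
    by move=> u v /colP uv; apply/colP=> i; have := uv i; rewrite !mxE => /intr_inj.
  apply: map_inj; rewrite map_mxM incE.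
  have -> : map_mx intr (\col_k ((m k)%:R - N%:R)) =
            \col_k (m k)%:R - const_mx N%:R :> 'cV[R]_#|C|.
    by apply/colP=> k; rewrite !mxE rmorphB !rmorph_nat.
  by rewrite mulmxBr -mE addrK.
have rkE : \rank (incidence R C) = t by rewrite -incE defA rank_pid_mx_equiv.
by rewrite rkE defA pid_mx_equiv_Delta.
Qed.
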